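(* The Banach lattice $\ell^\infty(\ell^2)$ fails the Hardy-Littlewood (HL) property.
   Context: $\ell^\infty(\ell^2)$ is the real Banach lattice of bounded sequences with values in $\ell^2$, with the coordinatewise order and the supremum norm of the $\ell^2$-norms. For a Banach lattice $X$, a finite set $J\subseteq(0,\infty)$ and $f\in L^1_{\rm loc}(\mathbb{R}^d;X)$ let $(\widetilde M_Jf)(\xi)=\sup_{r\in J}\frac{1}{|B_\xi(r)|}\int_{B_\xi(r)}|f(\eta)|\,d\eta$, $\xi\in\mathbb{R}^d$, with modulus and supremum in the lattice sense of $X$ and $B_\xi(r)$ the ball with centre $\xi$ and radius $r$. $X$ has the Hardy-Littlewood property (is an HL space) if for all $p\in(1,\infty)$ and $d\ge1$ there is a finite constant $C=C_{p,d,X}$ such that for all finite $J\subseteq(0,\infty)$ and all $f\in L^p(\mathbb{R}^d;X)$ one has $\widetilde M_Jf\in L^p(\mathbb{R}^d;X)$ and $\|\widetilde M_Jf\|_{L^p(\mathbb{R}^d;X)}\le C\|f\|_{L^p(\mathbb{R}^d;X)}$. *)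

(* Defs.v *)
From HB Require Import structures.
From mathcomp Require Import all_boot all_order all_algebra.
From mathcomp Require Import finmap ring lra.
From mathcomp Require Import all_classical all_reals all_analysis.

Set Implicit Arguments.
Unset Strict Implicit.
Unset Printing Implicit Defensive.
Import Order.TTheory GRing.Theory Num.Theory.
Import numFieldNormedType.Exports.
Local Open Scope classical_set_scope.
Local Open Scope ring_scope.

(* The order is a field of the mixin because Hierarchy Builder rejects a
   structure inheriting from both [Order.Preorder] and [NormedModule] declared
   after [Num.NumDomain]. Joins are enough: the meet of x and y is
   - (vjoin (- x) (- y)). *)
HB.mixin Record isBanachLattice (R : realType) X & CompleteNormedModule R X := {
  vle : X -> X -> Prop;
  vle_refl : forall x, vle x x;
  vle_anti : forall x y, vle x y -> vle y x -> x = y;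
  vle_trans : forall y x z, vle x y -> vle y z -> vle x z;
  vleD2r : forall z x y : X, vle x y -> vle (x + z) (y + z);
  vscale_ge0 : forall (a : R) (x : X), 0 <= a -> vle 0 x -> vle 0 (a *: x);
  vjoin : X -> X -> X;
  vjoinP : forall x y z : X, vle (vjoin x y) z <-> vle x z /\ vle y z;
  vnorm_le : forall x y : X, vle (vjoin x (- x)) (vjoin y (- y)) -> `|x| <= `|y|
}.

#[short(type="banachLatticeType")]
HB.structure Definition BanachLattice (R : realType) :=
  {X of CompleteNormedModule R X & isBanachLattice R X}.

Definition vabs {R : realType} {X : banachLatticeType R} (x : X) : X :=
  vjoin x (- x).

Arguments vle_anti {R s} [x y] _ _.
Arguments vle_trans {R s} [y x z] _ _.
Arguments vleD2r {R s} z [x y] _.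
Arguments vscale_ge0 {R s} [a x] _ _.
Arguments vjoinP {R s} {x y z}.
Arguments vnorm_le {R s} [x y] _.

Section BanachLatticeTheory.
Context {R : realType} {X : banachLatticeType R}.
Implicit Types x y z : X.

Lemma vle_joinl x y : vle x (vjoin x y).
Proof. by have /vjoinP[] := vle_refl (vjoin x y). Qed.

Lemma vle_joinr x y : vle y (vjoin x y).
Proof. by have /vjoinP[] := vle_refl (vjoin x y). Qed.

Lemma vleD x y z t : vle x y -> vle z t -> vle (x + z) (y + t).
Proof.
move=> xy zt; apply: vle_trans (vleD2r z xy) _.
by rewrite ![y + _]addrC; exact: vleD2r.
Qed.

Lemma vleN x y : vle x y -> vle (- y) (- x).
Proof.
by move=> /(vleD2r (- x - y)); rewrite addrA subrr add0r addrCA subrr addr0.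
Qed.

Lemma vabs_ge0 x : vle 0 (vabs x).
Proof.
have : vle 0 (vabs x + vabs x).
  by rewrite -(subrr x); apply: vleD; [exact: vle_joinl|exact: vle_joinr].
have h : 0 <= 2^-1 :> R by rewrite invr_ge0.
move=> /(vscale_ge0 h).
by rewrite -mulr2n -[vabs x *+ 2]scaler_nat scalerA mulVf// scale1r.
Qed.

Lemma vabs_id x : vle 0 x -> vabs x = x.
Proof.
move=> x0; apply: vle_anti; last exact: vle_joinl.
apply/vjoinP; split; first exact: vle_refl.
by apply: (vle_trans _ x0); rewrite -oppr0; exact: vleN.
Qed.

Lemma vnorm_abs x : `|vabs x| = `|x|.
Proof.
have E : vabs (vabs x) = vabs x by exact/vabs_id/vabs_ge0.
by apply: le_anti; rewrite !vnorm_le// -!/(vabs _) E; exact: vle_refl.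
Qed.

Lemma vnorm_join x y : `|vjoin x y| <= `|x| + `|y|.
Proof.
rewrite -(vnorm_abs x) -(vnorm_abs y) (le_trans _ (ler_normD _ _))//.
apply: vnorm_le; rewrite -!/(vabs _) [vabs (_ + _)]vabs_id; last first.
  by rewrite -(addr0 0); apply: vleD; exact: vabs_ge0.
have xa z t : vle z (vabs z + vabs t).
  by rewrite -[X in vle X _]addr0; apply: vleD; [exact: vle_joinl|exact: vabs_ge0].
apply/vjoinP; split.
  by apply/vjoinP; split => //; rewrite addrC.
apply: (@vle_trans _ _ (- x)); first exact/vleN/vle_joinl.
rewrite -[X in vle X _]addr0; apply: vleD; [exact: vle_joinr|exact: vabs_ge0].
Qed.

End BanachLatticeTheory.

Section Ell2.
Context {R : realType}.
Implicit Types (x y : nat -> R).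

Let psum x N := \sum_(0 <= n < N) x n ^+ 2.

Definition square_summable : {pred nat -> R} :=
  fun x => `[< cvgn (series (fun n => x n ^+ 2)) >].

Let psum_ndecr x : nondecreasing_seq (series (fun n => x n ^+ 2)).
Proof. by apply: (@nondecreasing_series R _ xpredT 0) => n _ _; apply: sqr_ge0. Qed.

Let psum_le_lim x N : x \in square_summable ->
  psum x N <= limn (series (fun n => x n ^+ 2)).
Proof. by move=> /asboolP cx; exact: (nondecreasing_cvgn_le (@psum_ndecr x) cx N). Qed.

Let psum_bound x c : (forall N, psum x N <= c) ->
  x \in square_summable /\ limn (series (fun n => x n ^+ 2)) <= c.
Proof.
move=> xc; have cx : cvgn (series (fun n => x n ^+ 2)).
  apply: nondecreasing_is_cvgn => //.
  by exists c => _ [N _ <-]; exact: xc.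
split; first exact/asboolP.
by apply: limr_le => //; apply: nearW => N; exact: xc.
Qed.

Let psumZ (a : R) x N : psum (a *: x) N = a ^+ 2 * psum x N.
Proof.
rewrite /psum mulr_sumr; apply: eq_bigr => i _.
by rewrite -exprMn.
Qed.

Let psumD x y (a b : R) N : 0 <= a -> 0 <= b ->
  psum x N <= a ^+ 2 -> psum y N <= b ^+ 2 -> psum (x + y) N <= (a + b) ^+ 2.
Proof.
move=> a0 b0 xa yb.
suff main (e : R) : 0 < e -> psum (x + y) N <= (a + b + e) ^+ 2.
  have S0 : 0 <= psum (x + y) N by apply: sumr_ge0 => i _; exact: sqr_ge0.
  rewrite -(sqr_sqrtr S0) ler_sqr ?nnegrE ?sqrtr_ge0 ?addr_ge0//.
  apply/ler_addgt0Pr => e e0.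
  by rewrite -ler_sqr ?nnegrE ?sqrtr_ge0 ?addr_ge0 ?(ltW e0)// sqr_sqrtr// main.
move=> e0; pose a' := a + e / 2; pose b' := b + e / 2.
have a'0 : 0 < a' by rewrite ltr_wpDl// divr_gt0.
have b'0 : 0 < b' by rewrite ltr_wpDl// divr_gt0.
have xa' : psum x N <= a' ^+ 2.
  rewrite (le_trans xa)// ler_sqr ?nnegrE ?(ltW a'0)//.
  by rewrite lerDl divr_ge0// ltW.
have yb' : psum y N <= b' ^+ 2.
  rewrite (le_trans yb)// ler_sqr ?nnegrE ?(ltW b'0)//.
  by rewrite lerDl divr_ge0// ltW.
have -> : a + b + e = a' + b' by rewrite /a' /b'; lra.
have t0 : 0 < b' / a' by rewrite divr_gt0.
have -> : (a' + b') ^+ 2 = (1 + b' / a') * a' ^+ 2 + (1 + a' / b') * b' ^+ 2.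
  by field; rewrite !gt_eqF.
apply: le_trans (lerD (ler_wpM2l _ xa') (ler_wpM2l _ yb')); last 2 first.
  by rewrite addr_ge0// ltW.
  by rewrite addr_ge0// ltW// divr_gt0.
rewrite /psum !mulr_sumr -big_split/=; apply: ler_sum => i _.
rewrite -subr_ge0 (_ : _ - _ = (b' * x i - a' * y i) ^+ 2 / (a' * b')).
  by rewrite divr_ge0 ?sqr_ge0// ltW// mulr_gt0.
by rewrite (_ : (x + y) i = x i + y i)//; field; rewrite !gt_eqF.
Qed.

Let nrm x := Num.sqrt (limn (series (fun n => x n ^+ 2))).

Let nrm_ge0 x : 0 <= nrm x. Proof. exact: sqrtr_ge0. Qed.

Let lim_ge0 x : x \in square_summable -> 0 <= limn (series (fun n => x n ^+ 2)).
Proof. by move=> /psum_le_lim - /(_ 0); rewrite /psum big_geq. Qed.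

Let psum_nrm x N : x \in square_summable -> psum x N <= nrm x ^+ 2.
Proof. by move=> xl; rewrite sqr_sqrtr ?lim_ge0// psum_le_lim. Qed.

Let nrm_le x (c : R) : 0 <= c -> (forall N, psum x N <= c ^+ 2) ->
  x \in square_summable /\ nrm x <= c.
Proof.
move=> c0 /psum_bound[xl xc]; split => //.
by rewrite -(ger0_norm c0) -sqrtr_sqr ler_wsqrtr.
Qed.

Let nrm_ge_coord x i : x \in square_summable -> `|x i| <= nrm x.
Proof.
move=> xl; rewrite -ler_sqr ?nnegrE// -normrX ger0_norm ?sqr_ge0//.
apply: le_trans (psum_nrm i.+1 xl); rewrite /psum big_nat_recr//= lerDr.
by apply: sumr_ge0 => k _; exact: sqr_ge0.
Qed.

Lemma square_summable_submod_closed : submod_closed square_summable.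
Proof.
split.
  suff : (0 : nat -> R) \in square_summable /\ nrm 0 <= 0 by case.
  apply: nrm_le => // N; rewrite /psum big1 ?expr0n// => i _.
  by rewrite expr0n.
move=> a x y xl yl.
have [||//] := @nrm_le (a *: x + y) (`|a| * nrm x + nrm y).
  by rewrite addr_ge0// mulr_ge0.
move=> N; apply: psumD; rewrite ?mulr_ge0//; last exact: psum_nrm.
by rewrite psumZ exprMn -normrX ger0_norm ?sqr_ge0// ler_wpM2l ?sqr_ge0// psum_nrm.
Qed.

HB.instance Definition _ := GRing.isSubmodClosed.Build R (nat -> R)
  square_summable square_summable_submod_closed.

Record ell2 := Ell2 {
  ell2_val :> nat -> R ;
  ell2_valP : ell2_val \in square_summable }.

HB.instance Definition _ := [isSub for ell2_val].
HB.instance Definition _ := [Choice of ell2 by <:].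
HB.instance Definition _ := [SubChoice_isSubLmodule of ell2 by <:].

Definition ell2_norm (x : ell2) : R :=
  Num.sqrt (limn (series (fun n => x n ^+ 2))).

Let ell2_normD (x y : ell2) : ell2_norm (x + y) <= ell2_norm x + ell2_norm y.
Proof.
have [||//] := @nrm_le (x + y) (ell2_norm x + ell2_norm y).
  by rewrite addr_ge0// nrm_ge0.
by move=> N; apply: psumD; rewrite ?nrm_ge0//; apply: psum_nrm; exact: ell2_valP.
Qed.

Let ell2_normZ_le (a : R) (x : ell2) : ell2_norm (a *: x) <= `|a| * ell2_norm x.
Proof.
have [||//] := @nrm_le (a *: x) (`|a| * ell2_norm x).
  by rewrite mulr_ge0// nrm_ge0.
move=> N; rewrite psumZ exprMn -normrX ger0_norm ?sqr_ge0// ler_wpM2l ?sqr_ge0//.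
by apply: psum_nrm; exact: ell2_valP.
Qed.

Let ell2_normZ (a : R) (x : ell2) : ell2_norm (a *: x) = `|a| * ell2_norm x.
Proof.
have [->|a0] := eqVneq a 0.
  apply: le_anti; rewrite ell2_normZ_le normr0 mul0r /=; exact: nrm_ge0.
apply: le_anti; rewrite ell2_normZ_le /= -{1}(scalerK a0 x).
rewrite (le_trans (ler_wpM2l _ (ell2_normZ_le a^-1 _)))//.
by rewrite mulrA -normrM mulfV// normr1 mul1r.
Qed.

Let ell2_norm_eq0 (x : ell2) : ell2_norm x = 0 -> x = 0.
Proof.
move=> x0; apply/val_inj/funext => n; apply/eqP; rewrite -normr_le0 -x0.
by apply: nrm_ge_coord; exact: ell2_valP.
Qed.

HB.instance Definition _ :=
  Lmodule_isNormed.Build R ell2 ell2_normD ell2_normZ ell2_norm_eq0.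

Lemma ell2_normE (x : ell2) :
  `|x| = Num.sqrt (limn (series (fun n => x n ^+ 2))).
Proof. by []. Qed.

Lemma ell2_norm_coord (x : ell2) n : `|x n| <= `|x|.
Proof. by apply: nrm_ge_coord; exact: ell2_valP. Qed.

Let ell2_complete (F : set_system ell2) : ProperFilter F -> cauchy F -> cvg F.
Proof.
move=> FF /cauchyP Fc.
have Fci n : cvg ((fun x : ell2 => x n) @ F).
  apply: cauchy_cvg; apply: cauchy_exP => e e0.
  have [x Fx] := Fc e e0; exists (x n).
  suff : F [set y : ell2 | ball (x n) e (y n)] by [].
  apply: filterS Fx => y; rewrite -!ball_normE /= => xy.
  by apply: le_lt_trans xy; exact: (ell2_norm_coord (x - y) n).
pose l : nat -> R := fun n => lim ((fun x : ell2 => x n) @ F).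
have near_l (e : R) (x : ell2) : 0 < e -> F (ball x e) ->
    ((x : nat -> R) - l) \in square_summable /\ nrm ((x : nat -> R) - l) <= e.
  move=> e0 Fx; apply: nrm_le; first exact: ltW.
  move=> N.
  have cl : (psum ((x : nat -> R) - (y : nat -> R)) N @[y --> F] -->
      psum ((x : nat -> R) - l) N).
    rewrite /psum; elim: N => [|N IH].
      under eq_fun do rewrite big_geq//; rewrite big_geq//; exact: cvg_cst.
    under eq_fun do rewrite big_nat_recr//=; rewrite big_nat_recr//=.
    apply: cvgD => //; rewrite expr2; set i := N.
    have : (x i - (y : ell2) i) @[y --> F] --> x i - l i.
      by apply: cvgB; [exact: cvg_cst|exact: Fci].
    by move=> h; exact: cvgM.
  rewrite -(cvg_lim _ cl)//; apply: limr_le.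
    by apply/cvg_ex; eexists; exact: cl.
  suff : F [set y : ell2 | psum ((x : nat -> R) - (y : nat -> R)) N <= e ^+ 2].
    by [].
  apply: filterS Fx => y; rewrite -ball_normE /= => xy.
  apply: le_trans (psum_nrm N (ell2_valP (x - y))) _.
  by rewrite ler_sqr ?nnegrE ?nrm_ge0 ?(ltW e0)//; exact: ltW.
have ll : l \in square_summable.
  have [x Fx] := Fc 1 ltr01; have [xl _] := near_l 1 x ltr01 Fx.
  rewrite (_ : l = (x : nat -> R) - ((x : nat -> R) - l)); last first.
    by rewrite opprB addrC subrK.
  by rewrite rpredB//; exact: ell2_valP.
apply/cvg_ex; exists (Ell2 ll); apply/cvgrPdist_le => e e0.
have e20 : 0 < e / 2 by rewrite divr_gt0.
have [x Fx] := Fc _ e20; have [_ xl] := near_l _ x e20 Fx.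
apply: filterS (Fx) => y; rewrite -ball_normE /= => xy.
rewrite /= (splitr e) (le_trans (ler_distD x _ _))// lerD//; last exact: ltW.
by rewrite distrC.
Qed.

HB.instance Definition _ := Uniform_isComplete.Build ell2 ell2_complete.

Let nrm_dom x y : (forall n, `|x n| <= `|y n|) -> y \in square_summable ->
  x \in square_summable /\ nrm x <= nrm y.
Proof.
move=> xy yl; apply: nrm_le; first exact: nrm_ge0.
move=> N; apply: le_trans (psum_nrm N yl); apply: ler_sum => i _.
by rewrite -[leLHS]ger0_norm ?sqr_ge0// -[leRHS]ger0_norm ?sqr_ge0//
  !normrX ler_sqr ?nnegrE.
Qed.

Let ell2_join_subproof (x y : ell2) :
  (fun n => Num.max (x n) (y n)) \in square_summable.
Proof.
have absP (z : ell2) : (fun n => `|z n|) \in square_summable.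
  have [|//] := @nrm_dom (fun n => `|z n|) z _ (ell2_valP z).
  by move=> n; rewrite normr_id.
have [|//] := @nrm_dom (fun n => Num.max (x n) (y n))
  ((fun n => `|x n|) + (fun n => `|y n|)) _ (rpredD (absP x) (absP y)).
move=> n; rewrite [leRHS]ger0_norm; last exact: addr_ge0.
rewrite /= maxEle; case: ifP => _.
  by rewrite [leRHS](_ : _ = `|x n| + `|y n|)// lerDr.
by rewrite [leRHS](_ : _ = `|x n| + `|y n|)// lerDl.
Qed.

Definition ell2_le (x y : ell2) : Prop := forall n, x n <= y n.

Definition ell2_join (x y : ell2) : ell2 := Ell2 (ell2_join_subproof x y).

Let ell2_le_refl (x : ell2) : ell2_le x x.
Proof. by move=> n; exact: lexx. Qed.

Let ell2_le_anti (x y : ell2) : ell2_le x y -> ell2_le y x -> x = y.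
Proof.
by move=> xy yx; apply/val_inj/funext => n; apply: le_anti; rewrite xy yx.
Qed.

Let ell2_le_trans (y x z : ell2) : ell2_le x y -> ell2_le y z -> ell2_le x z.
Proof. by move=> xy yz n; exact: le_trans (xy n) (yz n). Qed.

Let ell2_leD2r (z x y : ell2) : ell2_le x y -> ell2_le (x + z) (y + z).
Proof. by move=> xy n; apply: lerD. Qed.

Let ell2_scale_ge0 (a : R) (x : ell2) :
  0 <= a -> ell2_le 0 x -> ell2_le 0 (a *: x).
Proof. by move=> a0 x0 n; apply: mulr_ge0 => //; exact: x0. Qed.

Let ell2_joinP (x y z : ell2) :
  ell2_le (ell2_join x y) z <-> ell2_le x z /\ ell2_le y z.
Proof.
split=> [xyz|[xz yz] n]; last by rewrite /= ge_max xz yz.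
by split=> n; have := xyz n; rewrite /= ge_max => /andP[].
Qed.

Let ell2_norm_le (x y : ell2) :
  ell2_le (ell2_join x (- x)) (ell2_join y (- y)) -> `|x| <= `|y|.
Proof.
move=> xy; have [|//] := @nrm_dom x y _ (ell2_valP y).
by move=> n; have := xy n; rewrite /= -!maxrN.
Qed.

HB.instance Definition _ := isBanachLattice.Build R ell2
  ell2_le_refl ell2_le_anti ell2_le_trans ell2_leD2r ell2_scale_ge0
  ell2_joinP ell2_norm_le.

End Ell2.
Arguments ell2 : clear implicits.

Section Ellinfty.
Context {R : realType} {X : banachLatticeType R}.
Implicit Types (x y : nat -> X).

Definition bounded_seq : {pred nat -> X} :=
  fun x => `[< has_ubound (range (fun n => `|x n|)) >].

Let nrm x := sup (range (fun n => `|x n|)).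

Let nrm_coord x n : x \in bounded_seq -> `|x n| <= nrm x.
Proof. by move=> /asboolP bx; apply: ub_le_sup => //; exists n. Qed.

Let nrm_ge0 x : x \in bounded_seq -> 0 <= nrm x.
Proof. by move=> /(nrm_coord 0); exact: le_trans. Qed.

Let nrm_le x (c : R) : (forall n, `|x n| <= c) ->
  x \in bounded_seq /\ nrm x <= c.
Proof.
move=> xc; split; first by apply/asboolP; exists c => _ [n _ <-].
apply: ge_sup; first by exists `|x 0|, 0.
by move=> _ [n _ <-].
Qed.

Lemma bounded_seq_submod_closed : submod_closed bounded_seq.
Proof.
split.
  suff : (0 : nat -> X) \in bounded_seq /\ nrm 0 <= 0 by case.
  by apply: nrm_le => n; rewrite normr0.
move=> a x y xl yl.
have [|//] := @nrm_le (a *: x + y) (`|a| * nrm x + nrm y).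
move=> n; rewrite (le_trans (ler_normD _ _))// lerD ?nrm_coord//.
by rewrite normrZ ler_wpM2l// nrm_coord.
Qed.

HB.instance Definition _ := GRing.isSubmodClosed.Build R (nat -> X)
  bounded_seq bounded_seq_submod_closed.

Record ellinfty := Ellinfty {
  ellinfty_val :> nat -> X ;
  ellinfty_valP : ellinfty_val \in bounded_seq }.

HB.instance Definition _ := [isSub for ellinfty_val].
HB.instance Definition _ := [Choice of ellinfty by <:].
HB.instance Definition _ := [SubChoice_isSubLmodule of ellinfty by <:].

Definition ellinfty_norm (x : ellinfty) : R := sup (range (fun n => `|x n|)).

Let coord (x : ellinfty) n : `|x n| <= ellinfty_norm x.
Proof. by apply: nrm_coord; exact: ellinfty_valP. Qed.

Let ellinfty_norm_le (x : ellinfty) (c : R) :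
  (forall n, `|x n| <= c) -> ellinfty_norm x <= c.
Proof. by move=> /nrm_le[]. Qed.

Let ellinfty_normD (x y : ellinfty) :
  ellinfty_norm (x + y) <= ellinfty_norm x + ellinfty_norm y.
Proof.
by apply: ellinfty_norm_le => n; rewrite (le_trans (ler_normD _ _))// lerD.
Qed.

Let ellinfty_normZ_le (a : R) (x : ellinfty) :
  ellinfty_norm (a *: x) <= `|a| * ellinfty_norm x.
Proof.
apply: ellinfty_norm_le => n.
by rewrite [leLHS](_ : _ = `|a *: x n|)// normrZ ler_wpM2l.
Qed.

Let ellinfty_normZ (a : R) (x : ellinfty) :
  ellinfty_norm (a *: x) = `|a| * ellinfty_norm x.
Proof.
have [->|a0] := eqVneq a 0.
  apply: le_anti; rewrite ellinfty_normZ_le normr0 mul0r /=.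
  by apply: nrm_ge0; exact: ellinfty_valP.
apply: le_anti; rewrite ellinfty_normZ_le /= -{1}(scalerK a0 x).
rewrite (le_trans (ler_wpM2l _ (ellinfty_normZ_le a^-1 _)))//.
by rewrite mulrA -normrM mulfV// normr1 mul1r.
Qed.

Let ellinfty_norm_eq0 (x : ellinfty) : ellinfty_norm x = 0 -> x = 0.
Proof.
by move=> x0; apply/val_inj/funext => n; apply/eqP; rewrite -normr_le0 -x0.
Qed.

HB.instance Definition _ := Lmodule_isNormed.Build R ellinfty
  ellinfty_normD ellinfty_normZ ellinfty_norm_eq0.

Lemma ellinfty_normE (x : ellinfty) : `|x| = sup (range (fun n => `|x n|)).
Proof. by []. Qed.

Lemma ellinfty_norm_coord (x : ellinfty) n : `|x n| <= `|x|.
Proof. exact: coord. Qed.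

Let ellinfty_complete (F : set_system ellinfty) :
  ProperFilter F -> cauchy F -> cvg F.
Proof.
move=> FF /cauchyP Fc.
have Fci n : cvg ((fun x : ellinfty => x n) @ F).
  apply: cauchy_cvg; apply: cauchy_exP => e e0.
  have [x Fx] := Fc e e0; exists (x n).
  suff : F [set y : ellinfty | ball (x n) e (y n)] by [].
  apply: filterS Fx => y; rewrite -!ball_normE /= => xy.
  by apply: le_lt_trans xy; exact: (ellinfty_norm_coord (x - y) n).
pose l : nat -> X := fun n => lim ((fun x : ellinfty => x n) @ F).
have near_l (e : R) (x : ellinfty) : 0 < e -> F (ball x e) ->
    ((x : nat -> X) - l) \in bounded_seq /\ nrm ((x : nat -> X) - l) <= e.
  move=> e0 Fx; apply: nrm_le => n.
  have cl : (`|x n - (y : ellinfty) n| @[y --> F] --> `|x n - l n|).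
    by apply: cvg_norm; apply: cvgB; [exact: cvg_cst|exact: Fci].
  rewrite [leLHS](_ : _ = `|x n - l n|)// -(cvg_lim _ cl)//.
  apply: limr_le.
    by apply/cvg_ex; eexists; exact: cl.
  suff : F [set y : ellinfty | `|x n - y n| <= e] by [].
  apply: filterS Fx => y; rewrite -ball_normE /= => xy.
  exact: le_trans (ellinfty_norm_coord (x - y) n) (ltW xy).
have ll : l \in bounded_seq.
  have [x Fx] := Fc 1 ltr01; have [xl _] := near_l 1 x ltr01 Fx.
  rewrite (_ : l = (x : nat -> X) - ((x : nat -> X) - l)); last first.
    by rewrite opprB addrC subrK.
  by rewrite rpredB//; exact: ellinfty_valP.
apply/cvg_ex; exists (Ellinfty ll); apply/cvgrPdist_le => e e0.
have e20 : 0 < e / 2 by rewrite divr_gt0.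
have [x Fx] := Fc _ e20; have [_ xl] := near_l _ x e20 Fx.
apply: filterS (Fx) => y; rewrite -ball_normE /= => xy.
rewrite /= (splitr e) (le_trans (ler_distD x _ _))// lerD//; last exact: ltW.
by rewrite distrC.
Qed.

HB.instance Definition _ := Uniform_isComplete.Build ellinfty ellinfty_complete.

Let ellinfty_join_subproof (x y : ellinfty) :
  (fun n => vjoin (x n) (y n)) \in bounded_seq.
Proof.
have [|//] := @nrm_le (fun n => vjoin (x n) (y n)) (`|x| + `|y|).
by move=> n; rewrite (le_trans (vnorm_join _ _))// lerD// ellinfty_norm_coord.
Qed.

Definition ellinfty_le (x y : ellinfty) : Prop := forall n, vle (x n) (y n).

Definition ellinfty_join (x y : ellinfty) : ellinfty :=
  Ellinfty (ellinfty_join_subproof x y).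

Let ellinfty_le_refl (x : ellinfty) : ellinfty_le x x.
Proof. by move=> n; exact: vle_refl. Qed.

Let ellinfty_le_anti (x y : ellinfty) :
  ellinfty_le x y -> ellinfty_le y x -> x = y.
Proof. by move=> xy yx; apply/val_inj/funext => n; exact: vle_anti. Qed.

Let ellinfty_le_trans (y x z : ellinfty) :
  ellinfty_le x y -> ellinfty_le y z -> ellinfty_le x z.
Proof. by move=> xy yz n; exact: vle_trans (xy n) (yz n). Qed.

Let ellinfty_leD2r (z x y : ellinfty) :
  ellinfty_le x y -> ellinfty_le (x + z) (y + z).
Proof. by move=> xy n; exact: vleD2r. Qed.

Let ellinfty_scale_ge0 (a : R) (x : ellinfty) :
  0 <= a -> ellinfty_le 0 x -> ellinfty_le 0 (a *: x).
Proof. by move=> a0 x0 n; exact: (vscale_ge0 a0 (x0 n)). Qed.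

Let ellinfty_joinP (x y z : ellinfty) :
  ellinfty_le (ellinfty_join x y) z <-> ellinfty_le x z /\ ellinfty_le y z.
Proof.
split=> [xyz|[xz yz] n]; last by apply/vjoinP; split.
by split=> n; have /vjoinP[] := xyz n.
Qed.

Let ellinfty_norm_mono (x y : ellinfty) :
  ellinfty_le (ellinfty_join x (- x)) (ellinfty_join y (- y)) -> `|x| <= `|y|.
Proof.
move=> xy; apply: ellinfty_norm_le => n.
exact: le_trans (vnorm_le (xy n)) (ellinfty_norm_coord y n).
Qed.

HB.instance Definition _ := isBanachLattice.Build R ellinfty
  ellinfty_le_refl ellinfty_le_anti ellinfty_le_trans ellinfty_leD2r
  ellinfty_scale_ge0 ellinfty_joinP ellinfty_norm_mono.

End Ellinfty.
Arguments ellinfty {R} X.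

(* R^d: tuples carry the product of the Borel sigma-algebras. *)
Notation Rn R d := (d.-tuple (measurableTypeR R)) (only parsing).

Section LebesgueTuple.
Context {R : realType}.

Section step.
Context (d : nat)
  (mu : {sigma_finite_measure set (Rn R d) -> \bar R}).

Let cons_pair (x : measurableTypeR R * Rn R d) : Rn R d.+1 :=
  cons_tuple x.1 x.2.
Let uncons_pair (t : Rn R d.+1) : measurableTypeR R * Rn R d :=
  (thead t, behead_tuple t).

Let cons_pairK : cancel cons_pair uncons_pair.
Proof.
case=> x t; rewrite /uncons_pair /cons_pair /=; congr pair.
by apply: val_inj.
Qed.

Let measurable_cons_pair : measurable_fun setT cons_pair.
Proof. exact: (@measurable_cons _ _ _ _ fst d snd). Qed.

Let measurable_uncons_pair : measurable_fun setT uncons_pair.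
Proof.
apply/measurable_fun_pairP; split.
- exact: measurable_tnth.
- exact: measurable_behead.
Qed.

Definition lebesgue_cons : set (Rn R d.+1) -> \bar R :=
  pushforward (@lebesgue_measure R \x mu)%E cons_pair.

HB.instance Definition _ := Measure.copy lebesgue_cons
  (measure_function_pushforward__canonical__measure_function_Measure
    (@lebesgue_measure R \x mu)%E measurable_cons_pair).

Let lebesgue_cons_sigma_finite : sigma_finite setT lebesgue_cons.
Proof.
have /sigma_finiteP[F [TF ndF Foo]] := sigma_finiteT (@lebesgue_measure R).
have /sigma_finiteP[G [TG ndG Goo]] := sigma_finiteT mu.
exists (fun n => uncons_pair @^-1` (F n `*` G n)).
  apply/esym; rewrite -subTset => t _.
  have [n _ Fn] : (\bigcup_i F i) (uncons_pair t).1 by rewrite -TF.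
  have [k _ Gk] : (\bigcup_i G i) (uncons_pair t).2 by rewrite -TG.
  exists (maxn n k) => //; split.
    by move: Fn; exact/subsetPset/ndF/leq_maxl.
  by move: Gk; exact/subsetPset/ndG/leq_maxr.
move=> n; have [mF Fn] := Foo n; have [mG Gn] := Goo n; split.
  rewrite -[X in measurable X]setTI; apply: measurable_uncons_pair => //.
  exact: measurableX.
rewrite /lebesgue_cons /pushforward -comp_preimage.
rewrite (_ : _ \o _ = id); last by apply/funext => x; exact: cons_pairK.
by rewrite preimage_id product_measure1E// lte_mul_pinfty// ge0_fin_numE.
Qed.

HB.instance Definition _ :=
  Measure_isSigmaFinite.Build _ _ _ lebesgue_cons lebesgue_cons_sigma_finite.

End step.

(* Lebesgue measure on the Borel subsets of R^d: the d-fold product of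
   [lebesgue_measure], a point mass when d = 0. *)
Fixpoint lebesgue_tuple d :
    {sigma_finite_measure set (Rn R d) -> \bar R} :=
  if d is d'.+1 then lebesgue_cons (lebesgue_tuple d')
  else \d_[tuple].

Lemma lebesgue_tuple_box d (A : 'I_d -> set (measurableTypeR R)) :
  (forall i, measurable (A i)) ->
  lebesgue_tuple d [set t | forall i, A i (tnth t i)] =
  (\prod_(i < d) lebesgue_measure (A i))%E.
Proof.
elim: d A => [|d IH] A mA /=.
  rewrite big_ord0 diracE mem_set//=; by case.
rewrite big_ord_recl -IH// /lebesgue_cons /pushforward.
rewrite -(@product_measure1E _ _ _ _ _ (@lebesgue_measure R)
  (lebesgue_tuple d))//.
  congr (_ _); apply/seteqP; split => [[x t]/= H|[x t]/= [Ax At] i].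
    split => /=; first by have := H ord0; rewrite tnth0.
    by move=> i; have := H (lift ord0 i); rewrite tnthS.
  by have [j ->|->] := unliftP ord0 i; rewrite ?tnthS ?tnth0.
rewrite (_ : [set _ | _] = \bigcap_(i in [set: 'I_d])
    ((@tnth _ _)^~ i @^-1` A (lift ord0 i))).
  apply: fin_bigcap_measurable => // i _.
  by rewrite -[X in measurable X]setTI; exact: measurable_tnth.
by apply/seteqP; split => t /= H i; [move=> _|]; exact: H.
Qed.
End LebesgueTuple.

Section BochnerIntegral.
Context d (T : measurableType d) {R : realType} (mu : {measure set T -> \bar R})
  (X : completeNormedModType R).

(* Nonzero values are taken on sets of finite measure. In [simple_integral] the
   value 0 contributes nothing, even if it is taken on a set of infinite
   measure. *)
Definition bochner_simple (s : T -> X) : Prop :=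
  finite_set (range s) /\
  forall v, v != 0 -> measurable (s @^-1` [set v]) /\
    (mu (s @^-1` [set v]) < +oo)%E.

Definition simple_integral (s : T -> X) : X :=
  \sum_(v \in range s) fine (mu (s @^-1` [set v])) *: v.

(* The a.e. limit makes this notion insensitive to null sets, so that Lebesgue
   (and not only Borel) strongly measurable functions are covered. The range is
   essentially separable, as always for Bochner spaces; this matters since X
   need not be separable. *)
Definition strongly_measurable (f : T -> X) : Prop :=
  exists s : nat -> T -> X, (forall n, bochner_simple (s n)) /\
    {ae mu, forall t, s n t @[n --> \oo] --> f t}.

Definition is_bochner_integral (f : T -> X) (v : X) : Prop :=
  strongly_measurable f /\
  exists s : nat -> T -> X,
    [/\ forall n, bochner_simple (s n),
        (\int[mu]_t (`|s n t - f t|)%:E @[n --> \oo] --> 0)%E &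
        simple_integral (s n) @[n --> \oo] --> v].

(* Total: an arbitrary value when [f] is not Bochner integrable on [A]. *)
Definition bochner_integral (A : set T) (f : T -> X) : X :=
  get (is_bochner_integral (fun t => \1_A t *: f t)).

(* Elements of L^p(mu; X) are handled through their representatives. *)
Definition bochner_norm (p : R) (f : T -> X) : \bar R :=
  Lnorm mu p%:E (fun t => (`|f t|)%:E).

Definition bochner_Lp (p : R) (f : T -> X) : Prop :=
  strongly_measurable f /\ (bochner_norm p f < +oo)%E.

End BochnerIntegral.

Section HardyLittlewood.
Context {R : realType} (X : banachLatticeType R).

(* Not [ball], which is relative to the sup norm on finite products. *)
Definition euclidean_ball d (xi : Rn R d) (r : R) :
    set (Rn R d) :=
  [set eta | Num.sqrt (\sum_(i < d) (tnth eta i - tnth xi i : R) ^+ 2) < r].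

Definition ball_average d (f : Rn R d -> X)
    (r : R) (xi : Rn R d) : X :=
  (fine (lebesgue_tuple d (euclidean_ball xi r)))^-1 *:
    bochner_integral (lebesgue_tuple d) (euclidean_ball xi r)
      (fun eta => vabs (f eta)).

(* Supremum of a finite family. The empty one, for which X has no least upper
   bound, is given the value 0, its supremum in the positive cone. *)
Definition vsup (s : seq X) : X :=
  if s is x :: s' then \big[vjoin/x]_(y <- s') y else 0.

Definition HL_maximal d (J : {fset R}) (f : Rn R d -> X)
    (xi : Rn R d) : X :=
  vsup [seq ball_average f r xi | r <- J].

Definition HL_property : Prop :=
  forall (p : R) (d : nat), 1 < p -> (1 <= d)%N ->
  exists C : R, forall (J : {fset R}) (f : Rn R d -> X),
    (forall r, r \in J -> 0 < r) ->
    bochner_Lp (lebesgue_tuple d) p f ->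
    bochner_Lp (lebesgue_tuple d) p (HL_maximal J f) /\
    (bochner_norm (lebesgue_tuple d) p (HL_maximal J f) <=
       C%:E * bochner_norm (lebesgue_tuple d) p f)%E.

End HardyLittlewood.

(* Main.v *)
Require Import Defs.
From HB Require Import structures.
From mathcomp Require Import all_boot all_order all_algebra.
From mathcomp Require Import finmap ring lra.
From mathcomp Require Import all_classical all_reals all_analysis.
From mathcomp Require Import measurable_realfun.

(** Coordinatewise, the maximal function does not respect the l^2 norm of a
    bounded function: the indicators e_k of the dyadic blocks
    [2^-(k+1), 2^-k[, k < K, are disjoint, so that the vector (e_k)_k has l^2
    norm at most 1 everywhere, but at the points of [0, 2^-K[ each e_k has
    average 1/4 over the ball of radius 2^-k, and the vector of these averages
    has l^2 norm at least sqrt K / 4. In l^2 alone this is harmless, since the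
    bad set [0, 2^-K[ is tiny. The supremum over the outer index makes it
    large: the n-th coordinate of the [witness] carries the same blocks
    translated by the [node] n / 2^K, n < 2^K, and the translates of the bad
    set cover [0, 1[. So the [witness] has norm at most 1 and is supported in
    [0, 2[ ([witness_norm_le]), whereas its maximal function for the radii
    2^-k, k < K, has norm at least sqrt K / 4 on the whole of [0, 1[
    ([HL_maximal_witness]). Letting K grow excludes any constant, for
    dimension 1 and exponent 2.

    The averages are Bochner integrals, specified only as some vector that is
    a limit of integrals of simple functions. They are evaluated through the
    coordinates, which are linear functionals of norm at most 1: such a
    functional commutes with the integral of a simple function and is
    compatible with the limits in the definition, so that it maps the Bochner
    integral of a simple function to the Lebesgue integral of its composition
    with that function ([bochner_integral_simple_scalar]). *)

Set Implicit Arguments.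
Unset Strict Implicit.
Unset Printing Implicit Defensive.
Import Order.TTheory GRing.Theory Num.Theory.
Import numFieldNormedType.Exports.
Local Open Scope classical_set_scope.
Local Open Scope ring_scope.

(** * Monotonicity of integrals and of L^p norms *)

Section IntegralBounds.
Context d (T : measurableType d) (R : realType) (mu : {measure set T -> \bar R}).
Local Open Scope ereal_scope.

(** The integral of a nonnegative function is the supremum of the integrals of
    the simple functions below it, hence it is monotone on arbitrary functions.
    This matters for the norm of a strongly measurable function, which is only
    almost everywhere a limit of measurable functions. *)
Lemma le_integral_nonneg (f g : T -> \bar R) :
  (forall x, 0 <= f x) -> (forall x, f x <= g x) ->
  \int[mu]_x f x <= \int[mu]_x g x.
Proof.
move=> f0 fg; have g0 x : 0 <= g x by exact: le_trans (f0 x) (fg x).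
rewrite !ge0_integralTE//; apply: le_ereal_sup => _ [h /= hf <-].
by exists h => //= x; exact: le_trans (hf x) (fg x).
Qed.

Lemma le_Lnorm (p : R) (f g : T -> \bar R) : (0 < p)%R ->
  (forall x, `|f x| <= `|g x|) -> 'N[mu]_p%:E[f] <= 'N[mu]_p%:E[g].
Proof.
move=> p0 fg; rewrite unlock /= gt0_ler_poweR//.
- by rewrite invr_ge0 ltW.
- by rewrite in_itv/= leey andbT; apply: integral_ge0 => x _; exact: poweR_ge0.
- by rewrite in_itv/= leey andbT; apply: integral_ge0 => x _; exact: poweR_ge0.
apply: le_integral_nonneg => x; first exact: poweR_ge0.
by rewrite gt0_ler_poweR// ?in_itv/= ?leey ?abse_ge0// ltW.
Qed.

Lemma Lnorm_indic (p c : R) (A : set T) : (0 < p)%R -> (0 <= c)%R ->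
  measurable A ->
  Lnorm mu p%:E (fun x => (c * \1_A x)%:E) = c%:E * mu A `^ p^-1.
Proof.
move=> p0 c0 mA; rewrite unlock /=.
rewrite (eq_integral (fun x => (c `^ p)%:E * (\1_A x)%:E)); last first.
  move=> x _; rewrite /= indicE; case: (x \in A); rewrite !(mulr1,mulr0)/=.
    by rewrite mule1 ger0_norm.
  by rewrite mule0 normr0 powR0// gt_eqF.
rewrite ge0_integralZl_EFin ?powR_ge0//=; last exact/measurable_EFinP.
rewrite integral_indic// setIT poweRM ?lee_fin ?powR_ge0//.
by rewrite poweR_EFin -powRrM mulfV ?gt_eqF// powRr1.
Qed.

Lemma integrable_indic_fin (A : set T) : measurable A -> mu A < +oo ->
  mu.-integrable setT (fun x => (\1_A x)%:E).
Proof.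
move=> mA Afin; apply/integrableP; split; first exact/measurable_EFinP.
rewrite (eq_integral (fun x => (\1_A x)%:E)); last first.
  by move=> t _; rewrite gee0_abs// lee_fin.
by rewrite integral_indic// setIT.
Qed.

End IntegralBounds.

(** * Bochner integrals of simple functions *)

Section SimpleFunctions.
Context d (T : measurableType d) (R : realType) (mu : {measure set T -> \bar R})
  (X : completeNormedModType R).
Implicit Types (f g s : T -> X).

(** A function of finitely many measurable truth values is simple: it factors
    through the finite type of bit vectors, and its level sets are unions of
    fibres of the bit vector [b]. *)
Lemma bochner_simple_bits (P : finType) (E : P -> set T) (D : set T) f :
  (forall p, measurable (E p)) -> measurable D -> (mu D < +oo)%E ->
  (forall t, ~ D t -> f t = 0) ->
  (forall t u, (forall p, E p t <-> E p u) -> f t = f u) ->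
  bochner_simple mu f.
Proof.
move=> mE mD Dfin f0 fD.
pose b t : {ffun P -> bool} := [ffun p => `[< E p t >]].
(* [h] factors [f] through [b]; off the range of [b] its value is 0. *)
pose h c : X := xget 0 [set v | exists2 t, b t = c & f t = v].
have fE t : f t = h (b t).
  rewrite /h; case: xgetP => [v -> [u bu <-]|/(_ (f t)) []]; last by exists t.
  apply: fD => p; move/ffunP: bu => /(_ p); rewrite !ffunE => e.
  by have [pu pt] := asbool_eq_equiv e.
have mb c : measurable (b @^-1` [set c]).
  rewrite (_ : _ @^-1` _ =
      \bigcap_(p in [set: P]) (if c p then E p else ~` E p)).
    apply: fin_bigcap_measurable => // p _; case: (c p) => //.
    exact: measurableC.
  apply/seteqP; split=> [t /= <- p _|t /= tc].
    by rewrite ffunE; case: asboolP.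
  apply/ffunP => p; rewrite ffunE; have := tc p I.
  by case: (c p) => ?; case: asboolP.
have mf v : measurable (f @^-1` [set v]).
  rewrite (_ : _ @^-1` _ = \bigcup_(c in [set c | h c = v]) b @^-1` [set c]).
    by apply: fin_bigcup_measurable.
  apply/seteqP; split=> [t /= <-|t [c /= hc bt]]; first by exists (b t).
  by rewrite fE bt.
split.
  apply: (@sub_finite_set _ _ (h @` setT)).
    by move=> _ [t _ <-]; exists (b t).
  exact: finite_image.
move=> v v0; split => //; apply: le_lt_trans Dfin; apply: le_measure.
- by rewrite inE.
- by rewrite inE.
move=> t /= tv; apply: contrapT => Dt.
by move: v0; rewrite -tv f0// eqxx.
Qed.

Variable (phi : {scalar X}).

Let phi0 : phi 0 = 0. Proof. exact: linear0. Qed.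

Let phiZ a x : phi (a *: x) = a * phi x. Proof. exact: linearZ. Qed.

Let phi_sum (r : seq X) (F : X -> X) :
  phi (\sum_(v <- r) F v) = \sum_(v <- r) phi (F v).
Proof. exact: linear_sum. Qed.

Let phiB x y : phi (x - y) = phi x - phi y. Proof. exact: linearB. Qed.

Lemma simple_scalarE s (F := fset_set (range s)) : finite_set (range s) ->
  forall t, phi (s t) = \sum_(v <- F) phi v * \1_(s @^-1` [set v]) t.
Proof.
move=> fs t; have sF : s t \in F by rewrite in_fset_set// inE; exists t.
rewrite (bigD1_seq (s t)) ?fset_uniq//=.
rewrite indicE mem_set// mulr1 big1 ?addr0// => v vst.
by rewrite indicE memNset ?mulr0//= => stv; rewrite stv eqxx in vst.
Qed.

Let term_integrable s v : bochner_simple mu s ->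
  mu.-integrable setT (fun t => (phi v * \1_(s @^-1` [set v]) t)%:E).
Proof.
move=> [fs ms]; have [->|v0] := eqVneq v 0.
  under eq_fun do rewrite linear0 mul0r; exact: integrable0.
have [mv vfin] := ms v v0.
under eq_fun do rewrite EFinM; apply: integrableZl => //.
exact: integrable_indic_fin.
Qed.

Lemma simple_scalar_integrable s : bochner_simple mu s ->
  mu.-integrable setT (EFin \o (fun t => phi (s t))).
Proof.
move=> bs; rewrite (_ : _ \o _ = fun t => \sum_(v <- fset_set (range s))
    (phi v * \1_(s @^-1` [set v]) t)%:E)%E; last first.
  by apply/funext => t /=; rewrite simple_scalarE ?sumEFin//; case: bs.
by apply: integrable_sum => // v _; exact: term_integrable.
Qed.

Lemma simple_scalar_integral s : bochner_simple mu s ->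
  (\int[mu]_t (phi (s t))%:E)%E = (phi (simple_integral mu s))%:E.
Proof.
move=> bs; have [fs ms] := bs.
under eq_integral do rewrite simple_scalarE// -sumEFin.
rewrite integral_sum//; last by move=> v; exact: term_integrable.
rewrite /simple_integral fsbig_finite//= phi_sum -sumEFin.
apply: eq_bigr => v _; have [->|v0] := eqVneq v 0.
  by rewrite scaler0 phi0; under eq_integral do rewrite mul0r; rewrite integral0.
have [mv vfin] := ms v v0.
under eq_integral do rewrite EFinM.
rewrite integralZl//; last exact: integrable_indic_fin.
by rewrite integral_indic// setIT phiZ mulrC EFinM fineK// ge0_fin_numE.
Qed.

Hypothesis phi_le : forall x, `|phi x| <= `|x|.

(** Any two limits of integrals of approximating simple functions agree under
    [phi]: |phi (int s_n) - phi (int g)| is at most the integral of |s_n - g|,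
    which tends to 0. *)
Lemma bochner_integral_scalar g v : bochner_simple mu g ->
  is_bochner_integral mu g v -> (phi v)%:E = (\int[mu]_t (phi (g t))%:E)%E.
Proof.
move=> bg [_ [s [bs s0 sv]]].
rewrite simple_scalar_integral//; congr EFin.
have dist n : ((`|phi (simple_integral mu (s n)) - phi (simple_integral mu g)|)%:E
    <= \int[mu]_t (`|s n t - g t|)%:E)%E.
  rewrite -abse_EFin EFinB -!simple_scalar_integral//.
  have ms := simple_scalar_integrable (bs n).
  have mg := simple_scalar_integrable bg.
  rewrite -integralB_EFin//.
  apply: le_trans (le_abse_integral _ _ _) _ => //.
    by apply: emeasurable_funB; [case/integrableP: ms|case/integrableP: mg].
  apply: le_integral_nonneg => t; first exact: abse_ge0.
  by rewrite -EFinB abse_EFin lee_fin -phiB phi_le.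
have cv : phi (simple_integral mu (s n)) @[n --> \oo] --> phi v.
  apply/cvgrPdist_le => e e0; move/cvgrPdist_le: sv => /(_ e e0).
  by apply: filterS => n; apply: le_trans; rewrite -phiB phi_le.
have cg : phi (simple_integral mu (s n)) @[n --> \oo] --> phi (simple_integral mu g).
  apply/cvgrPdist_le => e e0.
  have d0 : (`|phi (simple_integral mu (s n)) - phi (simple_integral mu g)|)%:E
      @[n --> \oo] --> 0%E.
    apply: squeeze_cvge s0; last exact: cvg_cst.
    by apply: nearW => n; rewrite dist lee_fin normr_ge0.
  move/fine_cvg/cvgrPdist_le: d0 => /(_ e e0); apply: filterS => n /=.
  by rewrite sub0r normrN normr_id distrC.
exact: (cvg_unique _ cv cg).
Qed.

(** The constant approximating sequence shows that a simple function is Bochner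
    integrable, so that its [bochner_integral] is a genuine integral and not an
    arbitrary value. *)
Lemma simple_is_bochner_integral g : bochner_simple mu g ->
  is_bochner_integral mu g (simple_integral mu g).
Proof.
move=> bg; split.
  by exists (fun=> g); split => //; apply: aeW => t; exact: cvg_cst.
exists (fun=> g); split => //; last exact: cvg_cst.
under eq_fun do under eq_integral do rewrite subrr normr0.
by rewrite integral0; exact: cvg_cst.
Qed.

Lemma bochner_integral_simple_scalar (A : set T) f :
  bochner_simple mu (fun t => \1_A t *: f t) ->
  (phi (bochner_integral mu A f))%:E = (\int[mu]_t (\1_A t * phi (f t))%:E)%E.
Proof.
move=> bf; under eq_integral do rewrite -phiZ.
apply: bochner_integral_scalar => //; apply: getPex.
exists (simple_integral mu (fun t => \1_A t *: f t)).
exact: simple_is_bochner_integral.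
Qed.

End SimpleFunctions.

(** * Suprema, norms and coordinates *)

Lemma vle_vsup (R : realType) (X : banachLatticeType R) (s : seq X) (x : X) :
  x \in s -> vle x (vsup s).
Proof.
case: s => // y s; rewrite /vsup inE => xs.
elim: s xs => [|z s IH].
  by rewrite big_nil orbF => /eqP ->; exact: vle_refl.
rewrite inE orbCA big_cons => /orP[/eqP ->|/IH xs]; first exact: vle_joinl.
exact: vle_trans xs (vle_joinr _ _).
Qed.

Section Ell2Bits.
Variable R : realType.

Lemma cvg_series_finsupp (u : nat -> R) (K : nat) :
  (forall k, (K <= k)%N -> u k = 0) ->
  series u @ \oo --> \sum_(0 <= k < K) u k.
Proof.
move=> u0; apply: cvg_near_cst; exists K => // n /= Kn.
rewrite /series /= (big_cat_nat _ Kn)//= [X in _ + X](_ : _ = 0) ?addr0//.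
by rewrite big_nat big1// => k /andP[Kk _]; exact: u0.
Qed.

Lemma bits_sqr (K : nat) (c : pred nat) k :
  ((((k < K)%N && c k)%:R : R) ^+ 2) = ((k < K)%N && c k)%:R.
Proof. by case: andb; rewrite ?expr1n ?expr0n. Qed.

Lemma bits_square_summable (K : nat) (c : pred nat) :
  (fun k => ((k < K)%N && c k)%:R : R) \in square_summable.
Proof.
apply/asboolP/cvg_ex; eexists; apply: (@cvg_series_finsupp _ K) => k Kk.
by rewrite ltnNge Kk/= expr0n.
Qed.

(** The truncation at [K] puts any sequence of bits into l^2, with norm at most
    sqrt K whatever the bits; this uniform bound is what makes a sequence of
    such vectors an element of l^infty(l^2). *)
Definition ell2_bits K c : ell2 R := Ell2 (bits_square_summable K c).

Lemma ell2_bits_norm K c :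
  `|ell2_bits K c| = Num.sqrt (\sum_(0 <= k < K) (c k)%:R).
Proof.
rewrite ell2_normE /=; congr Num.sqrt; apply: cvg_lim => //.
rewrite [X in _ --> X](_ : _ =
    \sum_(0 <= k < K) (((k < K)%N && c k)%:R : R) ^+ 2).
  by apply: cvg_series_finsupp => k Kk; rewrite ltnNge Kk/= expr0n.
by apply: eq_big_nat => k /andP[_ kK]; rewrite bits_sqr kK.
Qed.

Lemma ell2_bits_norm_le K c : `|ell2_bits K c| <= Num.sqrt K%:R.
Proof.
rewrite ell2_bits_norm ler_wsqrtr// -[K in K%:R]subn0 -sumr_const_nat.
by apply: ler_sum => k _; case: (c k).
Qed.

(** [x] dominates in modulus [a] times the indicator of the first [K] indices,
    and the norm is monotone. *)
Lemma ell2_norm_ge K (a : R) (x : ell2 R) : 0 <= a ->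
  (forall k, (k < K)%N -> a <= x k) -> a * Num.sqrt K%:R <= `|x|.
Proof.
move=> a0 ax; have -> : a * Num.sqrt K%:R = `|a *: ell2_bits K xpredT|.
  rewrite normrZ ger0_norm// ell2_bits_norm; congr (_ * Num.sqrt _).
  by rewrite sumr_const_nat subn0.
set y := a *: ell2_bits K xpredT.
suff h : ell2_le (ell2_join y (- y)) (ell2_join x (- x)) by exact: (vnorm_le h).
move=> k; change (Num.max (y k) (- (y k)) <= Num.max (x k) (- x k)).
rewrite !maxrN.
have -> : y k = a * ((k < K)%N && true)%:R by [].
rewrite andbT; case: ltnP => [kK|_].
  by rewrite mulr1 ger0_norm// (le_trans (ax k kK))// ler_norm.
by rewrite mulr0 normr0.
Qed.

End Ell2Bits.

Section EllinftyTheory.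
Variables (R : realType).

Lemma ellinfty_norm_le (X : banachLatticeType R) (x : ellinfty X) (c : R) :
  (forall n, `|x n| <= c) -> `|x| <= c.
Proof.
move=> xc; rewrite ellinfty_normE; apply: ge_sup; first by exists `|x 0%N|, 0%N.
by move=> _ [n _ <-].
Qed.

Definition coordinate (n k : nat) (x : ellinfty (ell2 R)) : R := x n k.

Lemma ellinfty_linE (X : banachLatticeType R) (a : R) (x y : ellinfty X) n :
  (a *: x + y) n = a *: x n + y n.
Proof. by []. Qed.

Lemma ell2_linE (a : R) (x y : ell2 R) k : (a *: x + y) k = a * x k + y k.
Proof. by []. Qed.

Lemma coordinate_scalar n k : scalar (coordinate n k).
Proof. by move=> a x y; rewrite /coordinate ellinfty_linE ell2_linE. Qed.

HB.instance Definition _ n k := GRing.isLinear.Build R (ellinfty (ell2 R)) R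
  *%R (coordinate n k) (@coordinate_scalar n k).

Lemma coordinate_norm n k x : `|coordinate n k x| <= `|x|.
Proof. exact: le_trans (ell2_norm_coord (x n) k) (ellinfty_norm_coord x n). Qed.

Lemma coordinateZ n k (a : R) (x : ellinfty (ell2 R)) :
  coordinate n k (a *: x) = a * coordinate n k x.
Proof. exact: linearZ. Qed.

Lemma ellinfty_vabsE (X : banachLatticeType R) (x : ellinfty X) n :
  vabs x n = vabs (x n).
Proof. by []. Qed.

Lemma ell2_vabsE (y : ell2 R) k : vabs y k = `|y k|.
Proof. by rewrite -maxrN. Qed.

Lemma coordinate_vabs n k (x : ellinfty (ell2 R)) :
  coordinate n k (vabs x) = `|coordinate n k x|.
Proof. by rewrite /coordinate ellinfty_vabsE ell2_vabsE. Qed.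

Lemma coordinate_vle n k (x y : ellinfty (ell2 R)) :
  vle x y -> coordinate n k x <= coordinate n k y.
Proof. by move=> /(_ n k). Qed.

Lemma bits_bounded K (c : nat -> pred nat) :
  (fun n => ell2_bits R K (c n)) \in bounded_seq.
Proof.
by apply/asboolP; exists (Num.sqrt K%:R) => _ [n _ <-]; exact: ell2_bits_norm_le.
Qed.

Definition ellinfty_bits K c : ellinfty (ell2 R) := Ellinfty (bits_bounded K c).

End EllinftyTheory.

(** * Lebesgue measure on the line *)

Section Line.
Variable R : realType.
Implicit Types (A : set (measurableTypeR R)).
Local Notation mu := (lebesgue_tuple 1).

(** The subsets of R seen in R^1, whose points are 1-tuples. *)
Definition online A : set (Rn R 1) := [set t | A (tnth t ord0)].

Lemma online_measurable A : measurable A -> measurable (online A).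
Proof.
move=> mA; rewrite -[online A]setTI.
exact: (@measurable_tnth _ _ _ ord0 measurableT _ mA).
Qed.

Lemma lebesgue_online A : measurable A ->
  lebesgue_tuple 1 (online A) = lebesgue_measure A.
Proof.
move=> mA; have := @lebesgue_tuple_box R 1 (fun=> A) (fun=> mA).
rewrite big_ord1 => <-; congr (_ _).
by apply/seteqP; split => t /= tA; [move=> i; rewrite ord1|exact: tA].
Qed.

Lemma lebesgue_online_itv (a b : R) x y : a <= b ->
  mu (online [set` Interval (BSide x a) (BSide y b)]) = (b - a)%:E.
Proof.
move=> ab; rewrite lebesgue_online; last exact: measurable_itv.
rewrite lebesgue_measure_itv/= lte_fin; case: ltP => // ba.
by rewrite (@le_anti _ _ a b) ?ab// subrr.
Qed.

Lemma Lnorm_online_itv (p c a b : R) x y : 0 < p -> 0 <= c -> a <= b ->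
  Lnorm mu p%:E
    (fun t => (c * \1_(online [set` Interval (BSide x a) (BSide y b)]) t)%:E) =
  (c * (b - a) `^ p^-1)%:E.
Proof.
move=> p0 c0 ab; rewrite Lnorm_indic//.
  by rewrite EFinM -poweR_EFin; congr (_ * _ `^ _)%E; exact: lebesgue_online_itv.
by apply: online_measurable; exact: measurable_itv.
Qed.

Lemma euclidean_ball1 (xi : Rn R 1) r : euclidean_ball xi r =
  online `]tnth xi ord0 - r, tnth xi ord0 + r[%classic.
Proof.
by apply/seteqP; split => t;
  rewrite /euclidean_ball /online /= big_ord1 sqrtr_sqr in_itv/= ltr_distl.
Qed.

End Line.

(** * Translated dyadic blocks *)

Section Witness.
Variables (R : realType) (K : nat).
Local Notation X := (ellinfty (ell2 R)).
Local Notation mu := (lebesgue_tuple 1).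
Implicit Types (s : R) (t : Rn R 1) (n k : nat).

Definition node n : R := n%:R / 2 ^+ K.

Definition block n k : interval R :=
  `[node n + 2 ^- k.+1, node n + 2 ^- k[.

Definition witness_bits s n : pred nat :=
  fun k => (n < 2 ^ K)%N && (s \in block n k).

Definition witness t : X := ellinfty_bits R K (witness_bits (tnth t ord0)).

Lemma exp2V_le1 k : 2 ^- k <= 1 :> R.
Proof. by rewrite -exprVn exprn_ile1// invf_le1 ?ler1n. Qed.

Lemma exp2V_gt0 k : 0 < 2 ^- k :> R.
Proof. by rewrite invr_gt0 exprn_gt0. Qed.

Lemma exp2VS k : 2 ^- k.+1 = 2 ^- k / 2 :> R.
Proof. by rewrite exprS invfM mulrC. Qed.

Lemma exp2V_ge k : (k < K)%N -> 2 ^- K <= 2 ^- k :> R.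
Proof.
by move=> kK; rewrite lef_pV2 ?posrE ?exprn_gt0// ler_weXn2l ?ler1n// ltnW.
Qed.

Lemma node_itv n : (n < 2 ^ K)%N -> 0 <= node n < 1.
Proof.
move=> nK; rewrite /node divr_ge0 ?exprn_ge0//= ltr_pdivrMr ?exprn_gt0//.
by rewrite mul1r -natrX ltr_nat.
Qed.

Lemma coordinate_witness n k t : (n < 2 ^ K)%N -> (k < K)%N ->
  coordinate n k (witness t) = \1_(online [set` block n k]) t.
Proof.
move=> nK kK; rewrite /coordinate /= kK /witness_bits nK indicE.
by congr (_ %:R); congr nat_of_bool; apply/idP/idP; rewrite inE.
Qed.

Lemma witness_bits_itv s n k : witness_bits s n k -> s \in `[0, 2[.
Proof.
move=> /andP[/node_itv/andP[n0 n1]]; rewrite !in_itv/= => /andP[ls sl].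
by have := exp2V_gt0 k.+1; have := exp2V_le1 k; move=> ? ?; apply/andP; split; lra.
Qed.

(** For fixed [n] the blocks are disjoint. The indicator of a block is the
    difference of the indicators of two half-lines, so the sum telescopes. *)
Lemma sum_witness_bits s n : \sum_(0 <= k < K) (witness_bits s n k)%:R <= 1 :> R.
Proof.
pose h k : R := (node n + 2 ^- k <= s)%R%:R.
have h01 k : 0 <= h k <= 1 by rewrite ler0n lern1 leq_b1.
apply: (@le_trans _ _ (\sum_(0 <= k < K) (h k.+1 - h k))); last first.
  rewrite telescope_sumr//; have := h01 K; have := h01 0%N; lra.
apply: ler_sum => k _; rewrite /h /witness_bits in_itv/=.
have k1k : 2 ^- k.+1 <= 2 ^- k :> R by rewrite exp2VS; have := exp2V_gt0 k; lra.
have [h1|h1] := lerP (node n + 2 ^- k.+1) s;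
  have [h2|h2] := lerP (node n + 2 ^- k) s; case: (_ < _)%N; rewrite //=; lra.
Qed.

Lemma witness_norm_le t : `|witness t| <= \1_(online `[0, 2[%classic) t.
Proof.
apply: ellinfty_norm_le => n.
rewrite [leLHS](_ : _ = `|ell2_bits R K (witness_bits (tnth t ord0) n)|)//.
rewrite ell2_bits_norm indicE; have [tD|tD] := boolP (t \in _).
  by rewrite -[leRHS]sqrtr1 ler_wsqrtr// sum_witness_bits.
rewrite big1 ?sqrtr0// => k _; case: (boolP (witness_bits _ _ _)) => //.
by move=> /witness_bits_itv tI; move: tD; rewrite notin_setE; case.
Qed.

Lemma witness_eq0 t : ~ online `[0, 2[%classic t -> witness t = 0.
Proof.
move=> tD; apply/eqP; rewrite -normr_le0 (le_trans (witness_norm_le t))//.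
by rewrite indicE memNset.
Qed.

(** The bits that determine the [witness], as required by
    [bochner_simple_bits]. *)
Let E (p : 'I_(2 ^ K) * 'I_K) : set (Rn R 1) := online [set` block p.1 p.2].

Let mE p : measurable (E p).
Proof. by apply: online_measurable; exact: measurable_itv. Qed.

Let witness_congr t u : (forall p, E p t <-> E p u) -> witness t = witness u.
Proof.
move=> tu; apply/val_inj/funext => n; apply/val_inj/funext => k /=.
case: ltnP => //= kK; rewrite /witness_bits; case: ltnP => //= nK.
have [h1 h2] := tu (Ordinal nK, Ordinal kK).
by congr (_ %:R); congr nat_of_bool; apply/idP/idP.
Qed.

Local Notation D := (online `[0%R, (2%R : R)[%classic).

Let D_measurable : measurable D.
Proof. by apply: online_measurable; exact: measurable_itv. Qed.

Let D_fin : (mu D < +oo)%E.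
Proof. by rewrite lebesgue_online_itv// ltry. Qed.

Lemma witness_simple : bochner_simple mu witness.
Proof.
exact: bochner_simple_bits mE D_measurable D_fin witness_eq0 witness_congr.
Qed.

Lemma witness_restrict_simple (A : set (Rn R 1)) : measurable A ->
  bochner_simple mu (fun t => \1_A t *: vabs (witness t)).
Proof.
(* Membership in [A] is one more bit. *)
move=> mA.
apply: (@bochner_simple_bits _ _ _ _ _ _ (oapp E A)) D_measurable D_fin _ _.
- by case=> [p|]; [exact: mE|exact: mA].
- by move=> t /witness_eq0 ->; rewrite vabs_id ?scaler0//; exact: vle_refl.
move=> t u tu; rewrite (@witness_congr t u); last first.
  by move=> p; exact: (tu (Some p)).
by rewrite !indicE; congr (_%:R *: _); congr nat_of_bool;
  have [h1 h2] := tu None; apply/idP/idP; rewrite !inE.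
Qed.

(** A point at distance less than 2^-K to the right of node [n] lies within
    2^-k of all of the block [n, k]. So the ball of radius 2^-k, of measure
    2 * 2^-k, contains that block, of measure 2^-(k+1). *)
Lemma ball_average_witness n k t : (n < 2 ^ K)%N -> (k < K)%N ->
  node n <= tnth t ord0 < node n + 2 ^- K ->
  coordinate n k (ball_average witness (2 ^- k) t) = 4^-1.
Proof.
move=> nK kK /andP[ns sn].
have k0 := exp2V_gt0 k; have Kk := exp2V_ge kK.
rewrite /ball_average euclidean_ball1.
set B := online _.
have mB : measurable B by apply: online_measurable; exact: measurable_itv.
have -> : fine (mu B) = 2 * 2 ^- k by rewrite lebesgue_online_itv/=; lra.
rewrite coordinateZ.
suff -> : coordinate n k
    (bochner_integral mu B (fun eta => vabs (witness eta))) = 2 ^- k.+1.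
  by rewrite exp2VS; field; rewrite gt_eqF.
apply: EFin_inj.
rewrite bochner_integral_simple_scalar; last 2 first.
- exact: coordinate_norm.
- exact: witness_restrict_simple.
transitivity (\int[mu]_u (\1_(online [set` block n k]) u)%:E)%E.
  apply: eq_integral => u _; congr EFin.
  rewrite /= coordinate_vabs coordinate_witness// !indicE.
  have [uE|] := boolP (u \in online [set` block n k]); last first.
    by rewrite normr0 mulr0.
  rewrite normr1 mulr1 mem_set//; move: uE; rewrite inE /B /online /= !in_itv/=.
  by move=> /andP[? ?]; have := exp2V_gt0 k.+1; move=> ?; apply/andP; split; lra.
rewrite integral_indic//; last by apply: online_measurable; exact: measurable_itv.
rewrite setIT; apply: (etrans (lebesgue_online_itv _ _ _)); last first.
  by rewrite exp2VS; congr EFin; field.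
by have := exp2VS k; have := exp2V_gt0 k; lra.
Qed.

Definition radii : {fset R} := [fset x in [seq 2 ^- k | k <- iota 0 K]]%fset.

Lemma radii_gt0 r : r \in radii -> 0 < r.
Proof. by rewrite inE => /mapP[k _ ->]; exact: exp2V_gt0. Qed.

Lemma exp2V_radii k : (k < K)%N -> 2 ^- k \in radii.
Proof. by move=> kK; rewrite inE; apply: map_f; rewrite mem_iota. Qed.

(** The translates of the bad set [0, 2^-K[ cover [0, 1[. *)
Lemma node_exists s : 0 <= s < 1 ->
  exists2 n, (n < 2 ^ K)%N & node n <= s < node n + 2 ^- K.
Proof.
move=> /andP[s0 s1]; have P0 : 0 < 2 ^+ K :> R by rewrite exprn_gt0.
have /andP[ns sn] : (Num.truncn (s * 2 ^+ K))%:R <= s * 2 ^+ K <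
    (Num.truncn (s * 2 ^+ K)).+1%:R by rewrite truncn_itv// mulr_ge0// ltW.
exists (Num.truncn (s * 2 ^+ K)).
  rewrite -(ltr_nat R) natrX (le_lt_trans ns)// gtr_pMl//.
rewrite (_ : node _ + _ = (Num.truncn (s * 2 ^+ K)).+1%:R / 2 ^+ K); last first.
  by rewrite /node -[(Num.truncn _).+1%:R]natr1 mulrDl mul1r.
by rewrite /node ler_pdivrMr// ltr_pdivlMr// ns sn.
Qed.

(** For [t] just to the right of node [n], the first [K] entries of the [n]-th
    coordinate of the maximal function are at least 1/4. *)
Lemma HL_maximal_witness t : 0 <= tnth t ord0 < 1 ->
  4^-1 * Num.sqrt K%:R <= `|Defs.HL_maximal radii witness t|.
Proof.
move=> /node_exists[n nK nt].
apply: le_trans (ellinfty_norm_coord (Defs.HL_maximal radii witness t) n).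
apply: ell2_norm_ge => // k kK.
rewrite -(ball_average_witness nK kK nt); apply: (@coordinate_vle _ n k).
by apply: vle_vsup; apply: map_f; exact: exp2V_radii.
Qed.

Lemma HL_maximal_witness_norm (p : R) : 0 < p ->
  ((4^-1 * Num.sqrt K%:R)%:E <=
    bochner_norm mu p (Defs.HL_maximal radii witness))%E.
Proof.
move=> p0; apply: (@le_trans _ _ (Lnorm mu p%:E
    (fun t => (4^-1 * Num.sqrt K%:R * \1_(online `[0, 1[%classic) t)%:E))).
  by rewrite Lnorm_online_itv ?mulr_ge0 ?sqrtr_ge0 ?invr_ge0// subr0 powR1 mulr1.
apply: le_Lnorm => // t; rewrite /= lee_fin normr_id indicE.
have [|_] := boolP (t \in _); last by rewrite mulr0 normr0.
rewrite inE /online /= in_itv/= mulr1 => t01.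
by rewrite ger0_norm ?mulr_ge0 ?sqrtr_ge0 ?invr_ge0// HL_maximal_witness.
Qed.

Lemma witness_bochner_norm (p : R) : 0 < p ->
  (bochner_norm mu p witness <= (2 `^ p^-1)%:E)%E.
Proof.
move=> p0; apply: (@le_trans _ _ (Lnorm mu p%:E
    (fun t => (1 * \1_(online `[0, 2[%classic) t)%:E))).
  apply: le_Lnorm => // t; rewrite /= lee_fin normr_id mul1r.
  by rewrite [leRHS]ger0_norm// witness_norm_le.
by rewrite Lnorm_online_itv// subr0 mul1r.
Qed.

End Witness.

(** * Failure of the maximal inequality *)

Unset Implicit Arguments.

Theorem proposition8p1 (R : realType) : ~ HL_property (ellinfty (ell2 R)).
Proof.
move=> /(_ 2 1%N (ltr1n _ 2) isT)[C HC].
pose c : R := `|C| * 2 `^ 2^-1.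
have bound K : 4^-1 * Num.sqrt K%:R <= c.
  have [|_ le] := HC (radii R K) (@witness R K) (@radii_gt0 R K).
    split.
      exists (fun=> @witness R K); split; first by move=> _; exact: witness_simple.
      by apply: aeW => t; exact: cvg_cst.
    exact: le_lt_trans (witness_bochner_norm K _) (ltry _).
  rewrite -lee_fin (le_trans (HL_maximal_witness_norm K (ltr0n _ 2)))//.
  apply: le_trans le _; rewrite EFinM.
  (* [C] may be negative, hence the absolute value. *)
  apply: (@le_trans _ _
    (`|C|%:E * bochner_norm (lebesgue_tuple 1) 2 (@witness R K))%E).
    by apply: lee_wpmul2r; [exact: Lnorm_ge0|rewrite lee_fin ler_norm].
  by apply: lee_wpmul2l; [rewrite lee_fin|exact: witness_bochner_norm].
have c0 : 0 <= c by rewrite mulr_ge0// powR_ge0.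
have := bound (Num.truncn ((4 * c) ^+ 2)).+1.
rewrite ler_pdivrMl// leNgt => /negP; apply.
rewrite -[ltLHS]ger0_norm ?mulr_ge0// -sqrtr_sqr ltr_sqrt ?ltr0n//.
exact: truncnS_gt.
Qed.
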